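(* (i) For non-regular connected $H$ there is a constant $c_H$ such that if $n \geq c_H$ and $G$ is a $2$-connected graph on $n$ vertices, then $$\hom(G,H) \leq \hom(K_{2,n-2},H),$$ with equality if and only if $G = K_{2,n-2}$. (ii) For $\Delta$-regular $H$ the same conclusion holds (there is a constant $c_H$ such that if $n \geq c_H$ and $G$ is a $2$-connected graph on $n$ vertices, then $\hom(G,H) \leq \hom(K_{2,n-2},H)$, with equality if and only if $G = K_{2,n-2}$) whenever $s(H) \geq 2\Delta^2 + 1$ (when $H$ is loopless and bipartite) or $s(H) \geq \Delta^2 + 1$ (otherwise).
   Context: The graph $G$ is simple and loopless; the target graph $H$ may have loops but has no multiple edges. For a simple loopless graph $G$ and a graph $H$, an $H$-coloring of $G$ is a map $f: V(G) \to V(H)$ such that $f(x)$ and $f(y)$ are adjacent in $H$ whenever $x$ and $y$ are adjacent in $G$; $\hom(G,H)$ is the number of $H$-colorings of $G$. $N(v) = \{w : v \sim w\}$ is the set of neighbors of $v$ (containing $v$ itself if $v$ is looped), and the degree of $v$ is $d(v) = |N(v)|$, so a loop at $v$ adds exactly one to its degree; regularity is meant with respect to this degree, and $\Delta$ denotes the maximum degree of $H$. $s(H)$ denotes the number of ordered pairs $(i,j)$ of (not necessarily distinct) vertices of $H$ satisfying $|N(i) \cap N(j)| = \Delta$. $K_{a,b}$ is the complete bipartite graph with $a$ and $b$ vertices in its two color classes. The constant $c_H$ depends on $H$ but not on $n$ or $G$.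
   Formalization: In (ii) H is also assumed connected, as in (i), and Δ ≥ 1: two disjoint looped vertices (s(H) = 2 = Δ²+1, hom(G,H) = 2 for every connected G) and loopless K_1 (hom(G,H) = 0) break the equality characterization. *)

(* Defs.v *)
From HB Require Import structures.
From mathcomp Require Import all_boot.

Set Implicit Arguments.
Unset Strict Implicit.
Unset Printing Implicit Defensive.

(* A finite graph without multiple edges; loops are allowed. *)
Record graph := Graph {
  vertex :> finType;
  adj : rel vertex;
  adj_sym : symmetric adj }.

Record sgraph := SGraph {
  sgraph_base :> graph;
  adj_irr : irreflexive (@adj sgraph_base) }.

Definition N (H : graph) (v : H) : {set H} := [set w | adj v w].

(* A loop at v contributes exactly one to the degree of v. *)
Definition deg (H : graph) (v : H) : nat := #|N v|.

Definition maxdeg (H : graph) : nat := \max_(v : H) deg v.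

Definition regular (H : graph) (d : nat) : Prop := forall v : H, deg v = d.

(* The pairs are ordered and may have equal components. *)
Definition s (H : graph) : nat :=
  #|[set p : H * H | #|N p.1 :&: N p.2| == maxdeg H]|.

Definition connected (H : graph) : Prop :=
  0 < #|H| /\ forall x y : H, connect (@adj H) x y.

Definition loopless (H : graph) : bool := [forall v : H, ~~ adj v v].

Definition bipartite (H : graph) : bool :=
  [exists A : {set H}, [forall x : H, [forall y : H,
     adj x y ==> ((x \in A) != (y \in A))]]].

Definition is_coloring (G : sgraph) (H : graph) (f : {ffun G -> H}) : bool :=
  [forall x : G, [forall y : G, adj x y ==> adj (f x) (f y)]].

Definition hom (G : sgraph) (H : graph) : nat :=
  #|[set f : {ffun G -> H} | is_coloring f]|.

Section DeleteVertex.
Variables (G : graph) (v : G).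

Definition del_adj : rel {x : G | x != v} := fun x y => adj (val x) (val y).

Lemma del_adj_sym : symmetric del_adj.
Proof. by move=> x y; apply: adj_sym. Qed.

Definition del_vertex : graph := Graph del_adj_sym.

End DeleteVertex.

Definition two_connected (G : graph) : Prop :=
  [/\ 2 < #|G|, connected G & forall v : G, connected (del_vertex v)].

Section CompleteBipartite.
Variables a b : nat.

Definition Kab_adj : rel ('I_a + 'I_b)%type :=
  fun x y => is_inl x != is_inl y.

Lemma Kab_adj_sym : symmetric Kab_adj.
Proof. by move=> x y; rewrite /Kab_adj eq_sym. Qed.

Lemma Kab_adj_irr : irreflexive Kab_adj.
Proof. by move=> x; rewrite /Kab_adj eqxx. Qed.

Definition Kab : sgraph := @SGraph (Graph Kab_adj_sym) Kab_adj_irr.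

End CompleteBipartite.

Definition isomorphic (G1 G2 : graph) : Prop :=
  exists2 f : G1 -> G2, bijective f & forall x y : G1, adj (f x) (f y) = adj x y.

(* Main.v *)
Require Import Defs.
From mathcomp Require Import all_boot.
From mathcomp Require Import zify.

Set Implicit Arguments.
Unset Strict Implicit.
Unset Printing Implicit Defensive.

(** Write D for the maximum degree of H and n for the number of vertices of G.
    Coloring the two vertices of the small side of K_{2,n-2} by a pair of twins
    (i, j), that is with |N(i) :&: N(j)| = D, leaves D choices for each of the
    other n - 2 vertices, so that K_{2,n-2} has at least s(H) D^(n-2) colorings
    (hom_K2_ge).  It must be shown that a 2-connected G with so many colorings
    contains K_{2,n-2}.

    The tool is the ear: a path that leaves a set S of vertices and comes back
    to S.  If its two ends are colored i and j and it has k edges, its k - 1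
    inner vertices can be colored in as many ways as there are walks of length
    k from i to j in H (extensions_ear).  Two facts about walks in H carry the
    proof.

    - There are fewer than D^2 walks of length 3 between any two vertices.
      Otherwise H would be a complete bipartite graph K_{D,D} or a complete graph
      with all its loops (complete_of_walks3), which is regular, and in which
      there are at most 2 D^2 or D^2 pairs of twins (few_twins_of_walks3).  So
      each ear with at least two inner vertices, called long, loses a constant
      factor against the D^(k-1) colorings that a tree would have.

    - For all large k, the number of walks of length k between two vertices is
      below s(H) D^(k-2) / |H|.  In a non-regular H the proportion of walks
      decays geometrically (walks_rare_nonregular).  In a regular H the walks
      equidistribute (walks_equidistribute), in number about D^k / |H|, or twice
      this in the bipartite case; that is where the hypothesis on s(H) enters.
      So a single very long ear already makes the colorings too few.

    Now let long ears be added to a single vertex for as long as possible.  If G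
    has many colorings, then by the two facts the ears are of bounded number
    and length, and the process stops at a set S of bounded size.  When no
    long ear is left, 2-connectedness forces every vertex outside S to have two
    neighbors in S (two_nbrs_inside); hence some pair a, b has many common
    neighbors (popular_pair).  The colorings in which a and b do not receive
    twins are then negligible.  Those in which they do number at most
    s(H) D^(n-2), and are fewer by a constant factor if a long ear starts from
    {a, b}.  So there is no such ear, and by two_nbrs_inside once more all other
    vertices are adjacent to both a and b (contains_K2_of_big_hom).

    Finally an edge of G that is not in K_{2,n-2} destroys a coloring: if it did
    not, any two vertices of H with a common neighbor would be adjacent
    (transitive_of_extra_edge), and H would again have D^2 walks of length 3
    between two vertices. *)

(** * Preliminaries *)

(** The inequality (1 + 1/b)^q >= 1 + q/b cleared of denominators, which keeps it
    meaningful for b = 0. *)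
Lemma bernoulli b q : (b + q) * b ^ q <= b * b.+1 ^ q.
Proof.
elim: q => [|q IH]; first by rewrite !expn0; lia.
rewrite !expnS; have := leq_mul2l b.+1 ((b + q) * b ^ q) (b * b.+1 ^ q).
rewrite IH orbT => IH'.
suff: (b + q.+1) * (b * b ^ q) <= b.+1 * ((b + q) * b ^ q) by lia.
by rewrite !mulnA leq_mul2r; apply/orP; right; nia.
Qed.

(** The loss of a factor (a - 1)/a, repeated often enough, outweighs any
    constant; all asymptotic comparisons are reduced to this one. *)
Lemma eventually_geometric c a : 0 < a ->
  exists m, forall q, m <= q -> c * a.-1 ^ q < a ^ q.
Proof.
case: a => // b _; exists (c * b).+1 => q ltq /=.
case: b ltq => [|b] ltq; first by rewrite exp0n ?muln0 ?exp1n //; lia.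
rewrite -(ltn_pmul2l (ltn0Sn b)); apply: leq_trans (bernoulli _ _).
by rewrite mulnA ltn_mul2r expn_gt0 /=; nia.
Qed.

Lemma eventually_finite (T : finType) (P : T -> nat -> Prop) :
    (forall x, exists m, forall k, m <= k -> P x k) ->
  exists m, forall k, m <= k -> forall x, P x k.
Proof.
move=> /fin_all_exists[f Pf]; exists (\max_x f x) => k lek x.
by apply: Pf; apply: leq_trans lek; apply: leq_bigmax.
Qed.

Lemma connected_closed (G : graph) (A : {set G}) x :
  connected G -> x \in A -> (forall y z, adj y z -> y \in A -> z \in A) ->
  A = setT.
Proof.
move=> [_ conG] xA clA; apply/setP => y; rewrite inE.
rewrite -(closed_connect _ (conG x y)) // => u v uv.
by apply/idP/idP; apply: clA; rewrite // adj_sym.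
Qed.

Lemma degE (H : graph) (i : H) : deg i = \sum_(j | adj i j) 1.
Proof. by rewrite sum1_card /deg; apply: eq_card => j; rewrite !inE. Qed.

Lemma deg_max (H : graph) (i : H) : deg i <= maxdeg H.
Proof. exact: (leq_bigmax i). Qed.

Lemma maxdeg_attained (H : graph) : 0 < #|H| -> exists v : H, deg v = maxdeg H.
Proof. by move=> /(eq_bigmax (@deg H))[v e]; exists v. Qed.

(** * Walks *)

Fixpoint walks (H : graph) k (i j : H) : nat :=
  if k is l.+1 then \sum_(c | adj i c) walks l c j else i == j.

Lemma leq_sum_nbrs (H : graph) (i : H) (F : H -> nat) M :
  (forall c, adj i c -> F c <= M) -> \sum_(c | adj i c) F c <= maxdeg H * M.
Proof.
move=> leF; apply: leq_trans (leq_sum _ leF) _.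
rewrite sum_nat_const leq_mul2r; apply/orP; right.
by rewrite -cardsE; apply: deg_max.
Qed.

Lemma walks1 (H : graph) (i j : H) : walks 1 i j = adj i j.
Proof.
rewrite /=; case ij: (adj i j).
  by rewrite (bigD1 j) //= eqxx big1 // => c /andP[_ /negPf->].
by rewrite big1 // => c ic; case: eqP ic ij => // -> ->.
Qed.

Lemma walksD (H : graph) k l (i j : H) :
  walks (k + l) i j = \sum_c walks k i c * walks l c j.
Proof.
elim: k i => [|k IH] i /=.
  rewrite (bigD1 i) //= eqxx mul1n big1 ?addn0 // => c.
  by rewrite eq_sym => /negPf->.
under [RHS]eq_bigr do rewrite big_distrl.
by rewrite exchange_big; apply: eq_bigr => c _; rewrite IH.
Qed.

Lemma walks_add_bound (H : graph) k l M (i j : H) :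
  (forall c : H, walks l c j <= M) -> walks (k + l) i j <= maxdeg H ^ k * M.
Proof.
move=> leM; elim: k i => [|k IH] i; first by rewrite expn0 mul1n.
by rewrite addSn expnS -mulnA /=; apply: leq_sum_nbrs => c _; apply: IH.
Qed.

Definition walks_from (H : graph) k (i : H) := \sum_j walks k i j.

Lemma walks_fromS (H : graph) k (i : H) :
  walks_from k.+1 i = \sum_(c | adj i c) walks_from k c.
Proof. by rewrite /walks_from exchange_big. Qed.

Lemma walks_from0 (H : graph) (i : H) : walks_from 0 i = 1.
Proof.
by rewrite /walks_from (bigD1 i) //= eqxx big1 // => j /negPf; rewrite eq_sym => ->.
Qed.

Lemma walks_from_bound (H : graph) k (i : H) : walks_from k i <= maxdeg H ^ k.
Proof.
elim: k i => [|k IH] i.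
  by rewrite walks_from0.
by rewrite walks_fromS expnS; apply: leq_sum_nbrs => c _; apply: IH.
Qed.

Lemma leq_walks_from (H : graph) k (i j : H) : walks k i j <= walks_from k i.
Proof. by rewrite /walks_from (bigD1 j) //= leq_addr. Qed.

Lemma walks_from_regular (H : graph) k (i : H) :
  regular H (maxdeg H) -> walks_from k i = maxdeg H ^ k.
Proof.
move=> regH; elim: k i => [|k IH] i.
  by rewrite walks_from0.
rewrite walks_fromS (eq_bigr (fun=> maxdeg H ^ k)) => [|c _]; last exact: IH.
by rewrite sum_nat_const expnS -(regH i) /deg /N cardsE.
Qed.

Lemma walks_to_regular (H : graph) k (j : H) :
  regular H (maxdeg H) -> \sum_i walks k i j = maxdeg H ^ k.
Proof.
move=> regH; elim: k => [|k IH] /=.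
  by rewrite (bigD1 j) //= eqxx big1 // => i /negPf ->.
rewrite (exchange_big_dep predT) //= expnS -IH big_distrr /=.
apply: eq_bigr => c _; rewrite sum_nat_const -(regH c); congr (_ * _).
by rewrite /deg; apply: eq_card => i; rewrite !inE adj_sym.
Qed.


Lemma walks_fromD (H : graph) k l (i : H) :
  walks_from (k + l) i = \sum_c walks k i c * walks_from l c.
Proof.
rewrite /walks_from; under eq_bigr do rewrite walksD.
by rewrite exchange_big; apply: eq_bigr => c _; rewrite big_distrr.
Qed.

Lemma walks_fromD_bound (H : graph) k l M (i : H) :
  (forall c : H, walks_from l c <= M) ->
  walks_from (k + l) i <= walks_from k i * M.
Proof.
move=> leM; rewrite walks_fromD big_distrl.
by apply: leq_sum => c _; rewrite leq_mul2l leM orbT.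
Qed.

(** * Long walks in a non-regular graph *)

(** Some walk from i reaches a vertex of degree below D, where the count of walks
    falls short of its maximum; the deficit is inherited backwards along the walk
    and by all longer walks. *)
Lemma walks_from_drop (H : graph) (i : H) : connected H ->
  ~ regular H (maxdeg H) ->
  exists m, forall k, m <= k -> walks_from k i < maxdeg H ^ k.
Proof.
move=> conH nregH.
have [v dv]: exists v : H, deg v < maxdeg H.
  case: (pickP (fun v : H => deg v < maxdeg H)) => [v dv|no]; first by exists v.
  case: nregH => v; apply/eqP.
  by rewrite eqn_leq deg_max /= leqNgt no.
have D0 : 0 < maxdeg H by apply: leq_trans dv.
have [m Pm]: exists m, walks_from m i < maxdeg H ^ m.
  have /connectP[p] := conH.2 i v.
  elim: p i => [|x p IH] i /= => [_ <-|/andP[ix xp] vE].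
    exists 1; rewrite expn1 walks_fromS (eq_bigr (fun=> 1)) -?degE // => c _.
    exact: walks_from0.
  have [m xm] := IH x xp vE; exists m.+1.
  have di := deg_max i; rewrite degE (bigD1 x) //= sum1_card in di.
  rewrite walks_fromS expnS (bigD1 x) //=.
  apply: leq_trans (leq_mul di (leqnn _)).
  rewrite mulSn -addSn leq_add // -sum_nat_const.
  by apply: leq_sum => c _; apply: walks_from_bound.
exists m => k /subnKC <-; apply: leq_ltn_trans (_ : _ <= _ * maxdeg H ^ (k - m)) _.
  by apply: walks_fromD_bound => c; apply: walks_from_bound.
by rewrite expnD ltn_mul2r expn_gt0 D0.
Qed.

(** Cut a walk into blocks of a length h.+1 for which all vertices show a deficit:
    each block costs a factor (R - 1)/R with R = D^(h+1). *)
Lemma walks_rare_nonregular (H : graph) c : connected H ->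
    ~ regular H (maxdeg H) ->
  exists l, forall k, l <= k -> forall i j : H, c * walks k i j < maxdeg H ^ k.
Proof.
move=> conH nregH; set D := maxdeg H.
have D0 : 0 < D.
  rewrite lt0n; apply/eqP => D0; apply: nregH => v.
  by apply/eqP; rewrite eqn_leq deg_max -/D D0.
have [h hP] : exists h, forall k, h <= k -> forall i : H, walks_from k i < D ^ k.
  by apply: eventually_finite => i; apply: walks_from_drop.
pose R := D ^ h.+1; have R0 : 0 < R by rewrite expn_gt0 D0.
have stepR q (i : H) : walks_from (q * h.+1) i <= R.-1 ^ q.
  elim: q i => [|q IH] i; first by rewrite walks_from0.
  rewrite mulSnr addnC expnS; apply: leq_trans (walks_fromD_bound _ _ _) _.
    by apply: IH.
  by rewrite leq_mul2r -ltnS prednK // hP // orbT.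
have [m mP] := eventually_geometric c R0; exists (m * h.+1) => k lek i j.
rewrite (divn_eq k h.+1) addnC.
apply: leq_ltn_trans (_ : _ <= D ^ (k %% h.+1) * (c * R.-1 ^ (k %/ h.+1))) _.
  rewrite mulnCA leq_mul2l; apply/orP; right.
  apply: leq_trans (leq_walks_from _ _ _) _.
  apply: leq_trans (walks_fromD_bound _ _ _) _; first exact: stepR.
  by rewrite leq_mul2r walks_from_bound orbT.
rewrite expnD ltn_mul2l expn_gt0 D0 /= [_ %/ _ * _]mulnC expnM mP //.
by rewrite leq_divRL.
Qed.

(** * Long walks in a regular graph *)

Section EvenWalks.

Variables (H : graph) (conH : connected H).
Hypotheses (regH : regular H (maxdeg H)) (D0 : 0 < maxdeg H).
Let D := maxdeg H.

Lemma regular_nbr (v : H) : exists w, adj v w.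
Proof.
have /card_gt0P[w] : 0 < #|N v| by rewrite -/(deg v) regH.
by rewrite inE; exists w.
Qed.

(** Walks are followed two steps at a time.  This relation is reflexive when
    every vertex has a neighbor, so the numbers of even walks become positive and
    stay so, and no discussion of periods is needed. *)
Definition two_steps : rel H := fun x y => [exists z, adj x z && adj z y].

Lemma two_steps_sym : symmetric two_steps.
Proof.
by move=> x y; apply/existsP/existsP => -[z /andP[xz zy]]; exists z;
   rewrite adj_sym zy adj_sym.
Qed.

Lemma connect_two_steps_sym : connect_sym two_steps.
Proof. exact: sym_connect_sym two_steps_sym. Qed.

Definition even_class (j : H) : {set H} := [set i | connect two_steps i j].

Lemma even_class_id j : j \in even_class j.
Proof. by rewrite inE. Qed.

Lemma even_class_step j x z y :
  adj x z -> adj z y -> x \in even_class j -> y \in even_class j.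
Proof.
move=> xz zy; rewrite !inE => xj; apply: connect_trans xj.
by rewrite connect_two_steps_sym connect1 //; apply/existsP; exists z; rewrite xz.
Qed.

Definition odd_class (j : H) : {set H} :=
  [set i | [exists x in even_class j, adj x i]].

Lemma even_odd_cover j : even_class j :|: odd_class j = setT.
Proof.
apply: (connected_closed (x := j)) conH _ _; first by rewrite inE even_class_id.
move=> y z yz; rewrite !in_setU => /orP[yE|].
  by apply/orP; right; rewrite inE; apply/exists_inP; exists y.
rewrite inE => /exists_inP[x xE xy]; apply/orP; left.
exact: even_class_step xy yz xE.
Qed.

Lemma even_odd_meet j x :
  x \in even_class j -> x \in odd_class j -> even_class j = setT.
Proof.
move=> xE xO; apply/setP => y; rewrite in_setT.
suff: y \in even_class j :&: odd_class j by rewrite in_setI => /andP[->].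
suff -> : even_class j :&: odd_class j = setT by rewrite inE.
apply: (connected_closed (x := x)) conH _ _; first by rewrite in_setI xE.
move=> u v uv; rewrite !in_setI => /andP[uE]; rewrite [_ \in odd_class _]inE.
move=> /exists_inP[w wE wu]; rewrite (even_class_step wu uv wE) /=.
by rewrite inE; apply/exists_inP; exists u.
Qed.

(** If some vertex of the even class of j is also at odd distance from j, parity
    is lost and the class is everything.  Otherwise the even and odd classes are
    the two sides of a bipartition, and counting the edges between them shows
    that in a regular graph the odd class is not the larger one. *)
Lemma card_even_class j :
  even_class j = setT \/ bipartite H /\ #|H| <= 2 * #|even_class j|.
Proof.
set E := even_class j; set O := odd_class j.
case: (pickP [pred x in E | x \in O]) => [x /andP[xE xO]|disj].
  by left; apply: even_odd_meet xE xO.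
have coverE x : (x \in O) = (x \notin E).
  have := disj x; have /setP/(_ x) := even_odd_cover j; rewrite !inE.
  by case: (connect _ _ _) => //= ->.
right; split.
  apply/existsP; exists E; apply/forallP => x; apply/forallP => y.
  apply/implyP => xy; case xE: (x \in E).
    suff: y \in O by rewrite coverE => /negPf->.
    by rewrite inE; apply/exists_inP; exists x.
  move/negbT: xE; rewrite -coverE inE => /exists_inP[z zE zx].
  by rewrite (even_class_step zx xy zE).
have -> : #|H| = #|E| + #|O|.
  rewrite -cardsT -(even_odd_cover j) cardsU -[E :&: O]/(_ :&: _).
  suff ->: E :&: O = set0 by rewrite cards0 subn0.
  by apply/setP => x; rewrite inE in_set0; apply: disj.
rewrite mul2n -addnn leq_add2l -(leq_pmul2l D0) -!(mulnC #|_|).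
have -> : #|O| * D = \sum_(x in O) \sum_(y in E) (adj x y : nat).
  rewrite -sum_nat_const; apply: eq_bigr => x xO.
  rewrite -[D](regH x) degE big_mkcond [RHS]big_mkcond.
  apply: eq_bigr => y _; case xy: (adj x y); last by case: ifP.
  move: xO; rewrite inE => /exists_inP[z zE zx].
  by rewrite (even_class_step zx xy zE).
rewrite exchange_big -sum_nat_const; apply: leq_sum => y _.
apply: leq_trans (deg_max y); rewrite degE big_mkcond [leqRHS]big_mkcond.
by apply: leq_sum => x _; rewrite adj_sym; case: (x \in O) => //; case: (adj y x).
Qed.

Lemma even_walks_pos : exists m, forall k, m <= k ->
  forall p : H * H, connect two_steps p.1 p.2 -> 0 < walks (2 * k) p.1 p.2.
Proof.
apply: eventually_finite => -[i j] /=.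
have step k x y z : two_steps x y -> 0 < walks (2 * k) y z ->
    0 < walks (2 * k.+1) x z.
  move=> /existsP[w /andP[xw wy]] pos; rewrite mulnS !addSn add0n /=.
  by rewrite (bigD1 w) //= (bigD1 y) //= -addnA ltn_addr.
case ij: (connect two_steps i j); last by exists 0.
have [k pos]: exists k, 0 < walks (2 * k) i j.
  case/connectP: ij => p; elim: p i => [|x p IH] i /=.
    by move=> _ ->; exists 0; rewrite muln0 /= eqxx.
  by case/andP=> ix xp jE; have [k /(step _ _ _ _ ix)] := IH x xp jE; exists k.+1.
exists k => l /subnK <- _; elim: (l - k) => // q IH.
apply: step IH; have [w iw] := regular_nbr i.
by apply/existsP; exists w; rewrite iw adj_sym.
Qed.

Lemma even_walks_outside k i j : ~~ connect two_steps i j -> walks (2 * k) i j = 0.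
Proof.
move=> ij; elim: k i ij => [|k IH] i ij.
  by rewrite muln0 /=; case: eqP ij => // ->; rewrite connect0.
rewrite mulnS !addSn add0n /=; apply: big1 => w iw; apply: big1 => x wx.
apply: IH; apply: contra ij; apply: connect_trans; apply: connect1.
by apply/existsP; exists w; rewrite iw.
Qed.

(** Doeblin's contraction argument.  Put R = D^(2m), where m is so large that any
    two vertices of an even class are joined by a walk of length 2m.  The number
    of walks to j of length 2m(q+1) from i is a sum of R of the numbers for
    length 2mq, and the smallest of these occurs in it for every i.  So the
    oscillation grows only by the factor R - 1 when the numbers themselves grow
    by R. *)
Lemma even_walks_oscillation : exists2 m, 0 < m & forall q i i' j,
  i \in even_class j -> i' \in even_class j ->
  walks (2 * m * q) i j <= walks (2 * m * q) i' j + (D ^ (2 * m)).-1 ^ q.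
Proof.
have [m m0 posm] : exists2 m, 0 < m & forall p : H * H,
    connect two_steps p.1 p.2 -> 0 < walks (2 * m) p.1 p.2.
  by have [m /(_ m.+1 (leqnSn _)) posm] := even_walks_pos; exists m.+1.
exists m => //; set R := D ^ (2 * m) => q i i' j.
elim: q i i' => [|q IH] i i' iC iC'.
  by rewrite muln0 expn0 /=; case: (i == j); case: (i' == j).
set u := fun x => walks (2 * m * q) x j in IH *.
have wE x : walks (2 * m * q.+1) x j = \sum_y walks (2 * m) x y * u y.
  by rewrite mulnS walksD.
have [z zC zmin] : exists2 z, z \in even_class j &
    forall y, y \in even_class j -> u z <= u y.
  by case: (arg_minnP u (even_class_id j)) => z; exists z.
have out x y : x \in even_class j -> y \notin even_class j ->
    walks (2 * m) x y = 0.
  rewrite !inE => xj yj; apply: even_walks_outside; apply: contra yj => xy.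
  by apply: connect_trans xj; rewrite connect_two_steps_sym.
apply: leq_trans (_ : _ <= R * u z + R.-1 ^ q.+1) _; last first.
  rewrite leq_add2r wE /R -(walks_from_regular _ i' regH) big_distrl.
  apply: leq_sum => y _; case yC: (y \in even_class j).
    by rewrite leq_mul2l zmin ?orbT.
  by rewrite (out i') ?yC.
rewrite wE -{1}[R](walks_from_regular (2 * m) i regH) /walks_from.
have pos : 0 < walks (2 * m) i z.
  apply: (posm (i, z)) => /=; move: iC zC; rewrite !inE => ij zj.
  by apply: (connect_trans ij); rewrite connect_two_steps_sym.
have RE : R.-1 = (walks (2 * m) i z).-1 + \sum_(y | y != z) walks (2 * m) i y.
  rewrite -{1}[R](walks_from_regular (2 * m) i regH) /walks_from (bigD1 z) //.
  by rewrite -!subn1 addnBAC.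
apply: leq_trans (_ : _ <= (\sum_y walks (2 * m) i y) * u z +
   (\sum_(y | y != z) walks (2 * m) i y) * R.-1 ^ q) _; last first.
  by rewrite leq_add2l expnS leq_mul2r {2}RE leq_addl orbT.
rewrite (bigD1 z) // [\sum_y walks (2 * m) i y](bigD1 z) // mulnDl -addnA leq_add2l.
rewrite -mulnDr big_distrl; apply: leq_sum => y _ /=.
case yC: (y \in even_class j); last by rewrite (out i) ?yC.
by rewrite leq_mul2l IH ?orbT.
Qed.


(** The walks of length 2mq that end in j all start in its even class, and there are
    R^q of them; as their numbers oscillate by at most (R - 1)^q over the starting
    vertices, none of these numbers is much larger than R^q divided by the size of
    the class.  The constant kappa bounds how many times the class fits into H. *)
Lemma walks_equidistribute kappa :
    0 < kappa -> (forall j, #|H| <= kappa * #|even_class j|) ->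
  forall c t, kappa * c < t -> exists l, forall k, l <= k ->
    forall i j : H, #|H| * c * walks k i j < t * D ^ k.
Proof.
move=> k0 leH c t ct.
have [m m0 osc] := even_walks_oscillation.
set R := D ^ (2 * m) in osc; have R0 : 0 < R by rewrite expn_gt0 D0.
have [q0 q0P] := eventually_geometric (kappa * c * #|H|) R0.
exists (2 * m * q0) => k lek i j.
set r := k %% (2 * m); set q := k %/ (2 * m).
have kE : k = r + 2 * m * q by rewrite /r /q addnC mulnC -divn_eq.
have {q0P} qP : kappa * c * #|H| * R.-1 ^ q < R ^ q.
  by apply: q0P; rewrite /q leq_divRL ?muln_gt0 // mulnC.
(* M is the total number of walks ending in j plus the accumulated oscillation. *)
set M := R ^ q + #|H| * R.-1 ^ q.
have leM x : #|even_class j| * walks (2 * m * q) x j <= M.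
  case xC: (x \in even_class j); last first.
    by rewrite -mulnA even_walks_outside ?muln0 //; rewrite inE in xC; rewrite xC.
  rewrite -sum_nat_const.
  apply: leq_trans (_ : _ <= \sum_(y in even_class j)
    (walks (2 * m * q) y j + R.-1 ^ q)) _.
    by apply: leq_sum => y yC; apply: osc.
  rewrite big_split sum_nat_const; apply: leq_add; last first.
    by rewrite leq_mul2r max_card orbT.
  rewrite -expnM -(walks_to_regular _ j regH) big_mkcond /=.
  by apply: leq_sum => y _; case: ifP.
have leX x : #|H| * c * walks (2 * m * q) x j < t * R ^ q.
  apply: leq_ltn_trans (_ : _ <= kappa * c * M) _.
    rewrite -[kappa * c * M]mulnA [c * M]mulnC mulnA mulnAC leq_mul2r.
    apply/orP; right.
    apply: leq_trans (_ : _ <= kappa * (#|even_class j| * walks (2 * m * q) x j)) _.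
      by rewrite mulnA leq_mul2r leH orbT.
    by rewrite leq_mul2l leM orbT.
  have := leq_mul ct (leqnn (R ^ q)); rewrite /M mulSn mulnDr mulnA; lia.
have [z zE] : {z | \max_x walks (2 * m * q) x j = walks (2 * m * q) z j}.
  by apply: eq_bigmax; apply: conH.1.
rewrite kE expnD [D ^ (_ * q)]expnM -/R.
apply: leq_ltn_trans (_ : _ <= D ^ r * (#|H| * c * walks (2 * m * q) z j)) _.
  rewrite mulnCA leq_mul2l; apply/orP; right; apply: walks_add_bound => x.
  by rewrite -zE; apply: (leq_bigmax x).
by rewrite [t * _]mulnCA ltn_mul2l expn_gt0 D0 leX.
Qed.

End EvenWalks.

(** * Walks of length three *)

Lemma walks2E (H : graph) (a j : H) : walks 2 a j = #|N a :&: N j|.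
Proof.
rewrite -[LHS]/(\sum_(b | adj a b) walks 1 b j).
under eq_bigr do rewrite walks1; rewrite -sum1_card.
rewrite big_mkcond [RHS]big_mkcond; apply: eq_bigr => b _.
by rewrite !inE [adj j b]adj_sym; case: (adj a b); case: (adj b j).
Qed.

Lemma codeg_max (H : graph) (a b : H) : #|N a :&: N b| <= maxdeg H.
Proof. exact: leq_trans (subset_leq_card (subsetIl _ _)) (deg_max a). Qed.

Lemma nbhd_eq (H : graph) (a b : H) : maxdeg H <= #|N a :&: N b| -> N a = N b.
Proof.
move=> le; have e (c : H) : N a :&: N b \subset N c -> N a :&: N b = N c.
  by move=> sub; apply/eqP; rewrite eqEcard sub (leq_trans (deg_max c) le).
by rewrite -(e a) ?subsetIl // (e b) ?subsetIr.
Qed.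

(** The walks of length 3 number the sum over the neighbors a of i of the sizes of
    N(a) :&: N(j).  To reach D^2 all these sets must have the full size D, so each
    neighbor of i has neighborhood N(j); symmetrically each neighbor of j has
    neighborhood N(i), and connectedness leaves no room for other vertices. *)
Lemma complete_of_walks3 (H : graph) (i j : H) :
    connected H -> 0 < maxdeg H -> maxdeg H ^ 2 <= walks 3 i j ->
  [/\ #|N i| = maxdeg H, #|N j| = maxdeg H, N i :|: N j = setT,
      forall a, a \in N i -> N a = N j & forall b, b \in N j -> N b = N i].
Proof.
move=> conH D0 le3.
have degi : #|N i| = maxdeg H.
  apply/eqP; rewrite eqn_leq (deg_max i) -(leq_pmul2r D0) mulnn.
  apply: leq_trans le3 _; rewrite -sum_nat_const /= big_mkcond.
  rewrite [leqRHS]big_mkcond; apply: leq_sum => a _; rewrite inE.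
  by case: ifP => // _; rewrite -[leqLHS]/(walks 2 a j) walks2E codeg_max.
have full a : a \in N i -> maxdeg H <= #|N a :&: N j|.
  move=> ia; rewrite leqNgt; apply/negP => lt.
  have : walks 3 i j < maxdeg H ^ 2.
    rewrite -[walks 3 i j]/(\sum_(a | adj i a) walks 2 a j).
    rewrite (bigD1 a) /=; last by rewrite inE in ia.
    rewrite -mulnn -{1}degi (cardsD1 a) ia mulnDl mul1n -addSn leq_add //.
      by rewrite -[X in X < _]/(walks 2 a j) walks2E.
    rewrite -sum_nat_const big_mkcond [leqRHS]big_mkcond.
    apply: leq_sum => b _; rewrite !inE andbC; case: ifP => // _.
    by rewrite -[leqLHS]/(walks 2 b j) walks2E codeg_max.
  by rewrite ltnNge le3.
have Na a : a \in N i -> N a = N j by move/full/nbhd_eq.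
have /card_gt0P[a0 a0i] : 0 < #|N i| by rewrite degi.
have degj : #|N j| = maxdeg H.
  apply/eqP; rewrite eqn_leq (deg_max j) (leq_trans (full a0 a0i)) //.
  by rewrite subset_leq_card // subsetIr.
have Nb b : b \in N j -> N b = N i.
  move=> bj; apply/esym/eqP; rewrite eqEcard degi (deg_max b) andbT.
  by apply/subsetP => a ai; rewrite inE adj_sym -[adj _ _]in_set -/(N a) Na.
split=> //; apply: (connected_closed (x := a0)) => //; first by rewrite inE a0i.
move=> y z yz; rewrite !in_setU => /orP[yi|yj].
  by rewrite orbC -(Na y) // inE yz.
by rewrite -(Nb y) // inE yz.
Qed.

Lemma regular_of_walks3 (H : graph) (i j : H) :
    connected H -> 0 < maxdeg H -> maxdeg H ^ 2 <= walks 3 i j ->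
  regular H (maxdeg H).
Proof.
move=> conH D0 /(complete_of_walks3 conH D0)[di dj cover Na Nb] v.
by have := in_setT v; rewrite -cover inE /deg => /orP[/Na|/Nb] ->.
Qed.

(** Here H is complete bipartite with sides N(i) and N(j), or these sets coincide
    and H is complete with all its loops.  Twins lie on the same side. *)
Lemma few_twins_of_walks3 (H : graph) (i j : H) :
    connected H -> 0 < maxdeg H -> maxdeg H ^ 2 <= walks 3 i j ->
  s H <= if loopless H && bipartite H then 2 * maxdeg H ^ 2 else maxdeg H ^ 2.
Proof.
move=> conH D0 /(complete_of_walks3 conH D0)[di dj cover Na Nb].
have coverP x : (x \in N i) || (x \in N j) by rewrite -in_setU cover inE.
case: (pickP [pred x in N i | x \in N j]) => [x /andP[xi xj]|disj].
  have eij : N i = N j by rewrite -(Nb x xj) (Na x xi).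
  have cH : #|H| = maxdeg H by rewrite -di -cardsT -cover -eij setUid.
  have : s H <= maxdeg H ^ 2.
    by rewrite /s -{2}cH -mulnn -card_prod max_card.
  by case: ifP => // _ /leq_trans; apply; rewrite leq_pmull.
have dis x : x \in N i -> x \in N j -> False.
  by move=> xi xj; have := disj x; rewrite /= xi xj.
have bip : bipartite H.
  apply/existsP; exists (N i); apply/forallP => x; apply/forallP => y.
  apply/implyP => xy; case/orP: (coverP x) => [xi|xj].
    have yj : y \in N j by rewrite -(Na x) // inE.
    by rewrite xi; case: (boolP (y \in N i)) => // yi; case: (dis y).
  have yi : y \in N i by rewrite -(Nb x) // inE.
  by rewrite yi; case: (boolP (x \in N i)) => // xi; case: (dis x).
have loopl : loopless H.
  apply/forallP => x; apply/negP => xx.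
  have /existsP[A /forallP/(_ x)/forallP/(_ x)] := bip.
  by rewrite xx eqxx.
rewrite bip loopl /=.
apply: leq_trans (_ : _ <= #|setX (N i) (N i) :|: setX (N j) (N j)|) _; last first.
  apply: leq_trans (leq_card_setU _ _) _.
  by rewrite !cardsX di dj mulnn mul2n addnn.
apply/subset_leq_card/subsetP => -[x y]; rewrite !inE /= => /eqP e.
have: (x \in N i) && (y \in N i) || (x \in N j) && (y \in N j); last by rewrite !inE.
have Nxy : N x = N y by apply: nbhd_eq; rewrite e.
have /card_gt0P[z zx] : 0 < #|N x|.
  by apply: leq_trans (subset_leq_card (subsetIl _ (N y))); rewrite e.
have zy : z \in N y by rewrite -Nxy.
case/orP: (coverP x) => xP; case/orP: (coverP y) => yP; rewrite ?xP ?yP ?orbT //;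
  case: (dis z).
- by rewrite -(Nb y).
- by rewrite -(Na x).
- by rewrite -(Nb x).
- by rewrite -(Na y).
Qed.

Lemma s_gt0 (H : graph) : 0 < #|H| -> 0 < s H.
Proof.
move=> /maxdeg_attained[v vD]; apply/card_gt0P; exists (v, v).
by rewrite inE setIid -/(deg v) vD.
Qed.

(** A vertex v of maximum degree is then looped, and each of its neighbors has the
    same neighborhood as v, so that all walks that start from v stay in N(v). *)
Lemma walks3_of_transitive (H : graph) : 0 < maxdeg H ->
    (forall i j c : H, adj c i -> adj c j -> adj i j) ->
  exists v : H, maxdeg H ^ 2 <= walks 3 v v.
Proof.
move=> D0 tr; have H0 : 0 < #|H|.
  by rewrite lt0n; apply: contraL D0 => /eqP/card0_eq H0;
     rewrite -eqn0Ngt /maxdeg big_pred0.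
have [v vD] := maxdeg_attained H0; exists v.
have /card_gt0P[w] : 0 < #|N v| by rewrite -/(deg v) vD.
rewrite inE => vw; have vv : adj v v by rewrite (tr v v w) // adj_sym.
have Nc c : adj v c -> N v \subset N c.
  by move=> vc; apply/subsetP => b; rewrite !inE => /(tr _ _ _ vc).
rewrite -mulnn -{1}vD degE big_distrl; apply: leq_sum => c vc /=.
rewrite mul1n -[leqRHS]/(walks 2 c v) walks2E -vD /deg.
by apply/subset_leq_card/subsetP => b bv; rewrite inE bv (subsetP (Nc c vc)).
Qed.

(** * Extending partial colorings *)

Section Extensions.

Variables (G : sgraph) (H : graph).
Let D := maxdeg H.
Implicit Types (S : {set G}) (f : G -> H).

(** The prescribed partial coloring is given by a total map f of which only the
    values on S are used; this avoids a type of partial colorings, and f may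
    then be any map. *)
Definition extensions S f : {set {ffun G -> H}} :=
  [set g | is_coloring g & [forall x in S, g x == f x]].

Definition recolor f w c : G -> H := fun x => if x == w then c else f x.

Lemma extensions_set0 f : #|extensions set0 f| = hom G H.
Proof.
apply: eq_card => g; rewrite !inE; case: is_coloring => //=.
by apply/forall_inP => x; rewrite inE.
Qed.

Lemma extensions_setT f : #|extensions setT f| <= 1.
Proof.
apply/card_le1_eqP => g h; rewrite !inE.
move=> /andP[_ /forall_inP gf] /andP[_ /forall_inP hf].
by apply/ffunP => x; rewrite (eqP (gf x _)) ?(eqP (hf x _)).
Qed.

Lemma coloringP (g : {ffun G -> H}) :
  reflect (forall x y : G, adj x y -> adj (g x) (g y)) (is_coloring g).
Proof.
apply: (iffP forallP) => [gP x y xy|gP x].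
  by have /forallP/(_ y)/implyP := gP x; apply.
by apply/forallP => y; apply/implyP; apply: gP.
Qed.

Lemma extensions_step S f w (C : {set H}) :
    (forall g, g \in extensions S f -> g w \in C) ->
  #|extensions S f| <= \sum_(c in C) #|extensions (w |: S) (recolor f w c)|.
Proof.
move=> inC; rewrite -sum1_card.
rewrite (partition_big (fun g : {ffun G -> H} => g w) (mem C)) //=.
apply: leq_sum => c _; rewrite sum1_card; apply/subset_leq_card/subsetP => g.
rewrite unfold_in /= !inE => /andP[/andP[-> /forall_inP gf] /eqP gw] /=.
apply/forall_inP => x; rewrite /recolor.
case: (x =P w) => [-> _|neq]; first by rewrite gw.
by rewrite !inE => /predU1P[//|/gf].
Qed.

Lemma extensions_step_nbr S f x w : x \in S -> adj x w ->
  #|extensions S f| <= \sum_(c | adj (f x) c) #|extensions (w |: S) (recolor f w c)|.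
Proof.
move=> xS xw; apply: leq_trans (extensions_step (w := w) (C := N (f x)) _) _.
  move=> g; rewrite !inE => /andP[/coloringP gP /forall_inP/(_ _ xS)/eqP <-].
  exact: gP.
by under eq_bigl do rewrite inE.
Qed.

Lemma boundary_edge S : connected G -> S != set0 -> S != setT ->
  exists x w, [/\ x \in S, w \notin S & adj x w].
Proof.
move=> conG /set0Pn[u uS] ST.
have [/existsP[x /existsP[w /and3P[]]]|] :=
  boolP [exists x, exists w, [&& x \in S, w \notin S & adj x w]].
  by exists x, w.
rewrite negb_exists => /forallP no; case/negP: ST; apply/eqP.
apply: (connected_closed conG uS) => y z yz yS; apply: contraT => zS.
by have := no y; rewrite negb_exists => /forallP/(_ z); rewrite yS zS yz.
Qed.

Lemma card_setC1U S w : w \notin S -> #|~: S| = #|~: (w |: S)|.+1.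
Proof.
by move=> wS; have := cardsC S; have := cardsC (w |: S); rewrite cardsU1 wS; lia.
Qed.

(** By connectedness the remaining vertices can be colored in an order in which
    each has an already colored neighbor, and so at most D possible colors. *)
Lemma extensions_connected S f : connected G -> S != set0 ->
  #|extensions S f| <= D ^ #|~: S|.
Proof.
move=> conG; move: {2}#|~: S| (erefl #|~: S|) => k.
elim: k S f => [|k IH] S f kE S0.
  move/eqP: kE; rewrite cards_eq0 => /eqP kE.
  by rewrite -[S]setCK kE setC0 setCT cards0; apply: extensions_setT.
have ST : S != setT by apply: contra_eq_neq kE => ->; rewrite setCT cards0.
have [x [w [xS wS xw]]] := boundary_edge conG S0 ST.
apply: leq_trans (extensions_step_nbr _ xS xw) _.
move: kE; rewrite (card_setC1U wS) => -[kE].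
rewrite expnS; apply: leq_sum_nbrs => c _; apply: IH => //.
by apply/set0Pn; exists w; rewrite setU11.
Qed.

Lemma setU_cons (w : G) p S :
  S :|: [set z in w :: p] = (w |: S) :|: [set z in p].
Proof. by rewrite set_cons setUCA setUA. Qed.

(** The colors met along the ear form a walk in H from f x to f y. *)
Lemma extensions_ear S f x y p M : x \in S -> y \in S ->
    path (@adj G) x (rcons p y) -> uniq p -> {in p, forall z, z \notin S} ->
    (forall f', #|extensions (S :|: [set z in p]) f'| <= M) ->
  #|extensions S f| <= walks (size p).+1 (f x) (f y) * M.
Proof.
elim: p S f x => [|w p IH] S f x xS yS.
  rewrite /= andbT => xy _ _ leM; rewrite -/(walks 1 _ _) walks1.
  have [fxy|nfxy] := boolP (adj (f x) (f y)).
    by rewrite mul1n; have := leM f; rewrite setU0.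
  rewrite leqn0 cards_eq0; apply/eqP/setP => g; rewrite !inE.
  apply: contraNF nfxy => /andP[/coloringP gP /forall_inP gf].
  by rewrite -(eqP (gf x xS)) -(eqP (gf y yS)) gP.
rewrite rcons_cons [path _ _ _]/= [uniq _]/= => /andP[xw wp] /andP[wNp up] outS leM.
have wS : w \notin S by apply: outS; rewrite mem_head.
apply: leq_trans (extensions_step_nbr _ xS xw) _.
rewrite -[walks _ _ _]/(\sum_(c | adj (f x) c) walks (size p).+1 c (f y)).
rewrite big_distrl; apply: leq_sum => c _.
rewrite -[leqRHS]/(walks (size p).+1 c (f y) * M).
have wE : recolor f w c w = c by rewrite /recolor eqxx.
have yE : recolor f w c y = f y.
  by rewrite /recolor; case: eqP wS => // <-; rewrite yS.
rewrite -[X in walks _ X]wE -[X in walks _ _ X]yE.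
apply: IH => //; rewrite ?setU11 ?setU1r //.
- move=> z zp; rewrite !inE negb_or outS ?inE ?zp ?orbT // andbT.
  by apply: contraNneq wNp => <-.
- by move=> f'; rewrite -setU_cons.
Qed.

Lemma extensions_common S f a b p M : a \in S -> b \in S ->
    {in p, forall z, [/\ z \notin S, adj a z & adj b z]} -> uniq p ->
    (forall f', #|extensions (S :|: [set z in p]) f'| <= M) ->
  #|extensions S f| <= #|N (f a) :&: N (f b)| ^ size p * M.
Proof.
elim: p S f => [|w p IH] S f aS bS pP.
  by move=> _ leM; rewrite mul1n; have := leM f; rewrite setU0.
rewrite [uniq _]/= => /andP[wNp up] leM; have [wS aw bw] := pP w (mem_head _ _).
apply: leq_trans (extensions_step (w := w) (C := N (f a) :&: N (f b)) _) _.
  move=> g; rewrite !inE => /andP[/coloringP gP /forall_inP gf].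
  by rewrite -(eqP (gf a aS)) -(eqP (gf b bS)) !gP.
have fE z c : z \in S -> recolor f w c z = f z.
  by rewrite /recolor => zS; case: eqP wS => // <-; rewrite zS.
apply: leq_trans (_ : \sum_(c in N (f a) :&: N (f b))
  (#|N (f a) :&: N (f b)| ^ size p * M) <= _).
  apply: leq_sum => c _; rewrite -{1}(fE a c aS) -{1}(fE b c bS).
  apply: IH; rewrite ?setU1r //; last by move=> f'; rewrite -setU_cons.
  move=> z zp; have [|zS -> ->] := pP z; first by rewrite inE zp orbT.
  by split=> //; rewrite !inE negb_or zS andbT; apply: contraNneq wNp => <-.
by rewrite sum_nat_const mulnA -expnS.
Qed.

End Extensions.

(** * Ears *)

Section Ears.

Variable G : sgraph.
Implicit Types (S : {set G}).

(** The ends x and y may coincide, so that the ear may close a cycle.  This makes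
    the absence of long ears a stronger condition, and it lets the growth
    start from a single vertex. *)
Definition long_ear S (x : G) p y :=
  [/\ x \in S /\ y \in S, path (@adj G) x (rcons p y), uniq p,
      {in p, forall z, z \notin S} & 1 < size p].

Lemma path_first_hit S (P : pred G) w q : w \notin S -> P w ->
    path (@adj G) w q -> all P q -> last w q \in S ->
  exists p z, [/\ path (@adj G) w (rcons p z), uniq (w :: p),
    {in p, forall u, u \notin S}, all P p & z \in S /\ P z].
Proof.
move=> wS Pw wq Pq qS.
have [p [z [wp pS Pp zS Pz]]] : exists p z, [/\ path (@adj G) w (rcons p z),
    {in p, forall u, u \notin S}, all P p, z \in S & P z].
  elim: q w wS {Pw} wq Pq qS => [|u q IH] w wS /=; first by rewrite (negPf wS).
  move=> /andP[wu uq] /andP[Pu Pq] qS.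
  have [uS|uS] := boolP (u \in S); first by exists [::], u; rewrite /= wu.
  have [p [z [up pS Pp zS Pz]]] := IH u uS uq Pq qS.
  exists (u :: p), z; split; rewrite /= ?wu ?Pu //.
  by move=> v; rewrite inE => /predU1P[->|/pS].
move: wp; rewrite rcons_path => /andP[wp]; case/shortenP: wp => p' wp' up' sub lastz.
exists p', z; split=> //; first by rewrite rcons_path wp'.
- by move=> u /sub/pS.
- by apply/allP => u /sub/(allP Pp).
Qed.

Lemma avoiding_path v w z : connected (del_vertex v) -> w != v -> z != v ->
  exists2 q, path (@adj G) w q & all (predC1 v) q /\ last w q = z.
Proof.
move=> [_ con] wv zv; pose w' : del_vertex v := Sub w wv.
have /connectP[q wq zE] := con w' (Sub z zv).
exists (map val q); last split.
- rewrite -[w]/(val w'); elim: q w' wq {zE} => //= u q IH w'.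
  by case/andP=> wu /IH ->; rewrite andbT.
- by apply/allP => _ /mapP[u _ ->]; apply: (valP u).
- by rewrite -[w]/(val w') last_map -zE.
Qed.

Lemma another_nbr (w x : G) : two_connected G -> w != x ->
  exists2 y, adj w y & y != x.
Proof.
move=> [G2 _ con] wx.
have [z zwx]: exists z, z \notin [set w; x].
  apply/existsP; rewrite -negb_forall; apply: contraL G2 => /forallP all2.
  have sub : [set: G] \subset [set w; x] by apply/subsetP => z _; apply: all2.
  by rewrite -leqNgt -cardsT (leq_trans (subset_leq_card sub)) ?cards2 ?wx.
move: zwx; rewrite !inE negb_or => /andP[zw zx].
have [[|y q] /= wq [Pq zE]] := avoiding_path (con x) wx zx.
  by rewrite zE eqxx in zw.
by case/andP: wq Pq => wy _ /andP[yx _]; exists y.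
Qed.

(** Suppose that u is outside S and adjacent to x in S and to v outside S.  Removing
    u leaves a path from v back to S, and this path preceded by x and u is an ear
    with at least two inner vertices.  So the vertices outside S that have a
    neighbor in S have no other neighbors, and by connectedness there are no
    vertices outside S besides these. *)
Lemma outside_nbrs S (w y : G) : two_connected G -> S != set0 ->
    (forall x p z, ~ long_ear S x p z) ->
  w \notin S -> adj w y -> y \in S.
Proof.
move=> tcG S0 noear.
have near u v x : u \notin S -> x \in S -> adj x u -> adj u v -> v \in S.
  move=> uS xS xu uv; apply: contraT => vS; have [_ _ con] := tcG.
  have uu t : t \in S -> t != u by move=> tS; apply: contraNneq uS => <-.
  have vu : v != u by apply: contraTneq uv => ->; rewrite adj_irr.
  have [q vq [Pq qE]] := avoiding_path (con u) vu (uu x xS).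
  have [|p [z [vp up pS Pp [zS Pz]]]] :=
    path_first_hit vS vu vq Pq; first by rewrite qE.
  case: (noear x [:: u, v & p] z); split=> //.
  - by rewrite rcons_cons rcons_cons /= xu uv.
  - rewrite cons_uniq up andbT inE negb_or eq_sym vu /=.
    by apply/negP => /(allP Pp); rewrite /= eqxx.
  - by move=> t; rewrite !inE => /or3P[/eqP->|/eqP->|/pS].
have [G2 conG _] := tcG.
have full : S :|: [set u | [exists x in S, adj x u]] = setT.
  have [x0 x0S] := set0Pn _ S0.
  apply: (connected_closed (x := x0) conG); first by rewrite inE x0S.
  move=> u v uv uP; have [uS|uS] := boolP (u \in S).
    by rewrite !inE; apply/orP; right; apply/exists_inP; exists u.
  move: uP; rewrite !inE (negPf uS) => /exists_inP[x xS xu].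
  by rewrite (near u v x).
move=> wS wy; have := in_setT w; rewrite -full !inE (negPf wS).
by move=> /exists_inP[x xS xw]; apply: near xw wy.
Qed.

Lemma two_nbrs_inside S (w : G) : two_connected G -> S != set0 ->
    (forall x p z, ~ long_ear S x p z) -> w \notin S ->
  exists x y, [/\ x \in S, y \in S, x != y, adj w x & adj w y].
Proof.
move=> tcG S0 noear wS; have [z zS] := set0Pn _ S0.
have wz : w != z by apply: contraNneq wS => ->.
have [x wx _] := another_nbr tcG wz.
have xw : w != x by apply: contraTneq wx => ->; rewrite adj_irr.
have [y wy yx] := another_nbr tcG xw.
have inS u : adj w u -> u \in S by apply: outside_nbrs.
by exists x, y; rewrite !inS // eq_sym.
Qed.

End Ears.

(** * Growing a set by long ears *)

Section Growth.

Variable H : graph.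
Let D := maxdeg H.
Hypotheses (H0 : 0 < #|H|) (D0 : 0 < D).
Hypothesis walks3_lt : forall i j : H, walks 3 i j < D ^ 2.

Lemma long_walks_bound k (i j : H) : walks (k + 3) i j <= D ^ k * (D ^ 2).-1.
Proof.
apply: walks_add_bound => c; rewrite -ltnS prednK ?expn_gt0 ?D0 //.
Qed.

Section Graph.

Variable G : sgraph.
Hypotheses (conG : connected G).
Implicit Types (S : {set G}).

Lemma ear_set_card S x p y : long_ear S x p y ->
  #|S :|: [set z in p]| = #|S| + size p.
Proof.
case=> _ _ up outS _; rewrite cardsU.
have -> : S :&: [set z in p] = set0.
  apply/setP => z; rewrite !inE; apply/andP => -[zS /outS].
  by rewrite zS.
by rewrite cards0 subn0 cardsE (card_uniqP up).
Qed.

Lemma extensions_long_ear S x p y (f : G -> H) M : long_ear S x p y ->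
    (forall f' : G -> H, #|extensions (S :|: [set z in p]) f'| <= M) ->
  #|extensions S f| <= D ^ (size p - 2) * (D ^ 2).-1 * M.
Proof.
move=> [[xS yS] xy up outS p2] leM.
apply: leq_trans (extensions_ear f xS yS xy up outS leM) _.
rewrite leq_mul2r; apply/orP; right.
have -> : (size p).+1 = size p - 2 + 3 by lia.
exact: long_walks_bound.
Qed.

(** The properties of a set S obtained from one vertex by adding t long ears, each
    with fewer than l inner vertices.  A tree on S would have at most
    |H| D^(|S|-1) colorings; each ear with r inner vertices has replaced the factor
    D^r by D^(r-2) (D^2 - 1).  The last clause says this relative to a bound M on the
    number of ways to color the rest of G. *)
Definition grown l t S := [/\ S != set0, #|S| <= 1 + t * l, 1 + 2 * t <= #|S| &
  forall M, (forall f : G -> H, #|extensions S f| <= M) ->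
    hom G H <= #|H| * ((D ^ 2).-1 ^ t * D ^ (#|S| - (1 + 2 * t))) * M].

Lemma hom_recolor (f : G -> H) u M :
    (forall f' : G -> H, #|extensions [set u] f'| <= M) ->
  hom G H <= #|H| * M.
Proof.
move=> leM; rewrite -(extensions_set0 f).
apply: leq_trans (extensions_step (w := u) (C := setT) _) _ => [g _|].
  by rewrite inE.
rewrite -cardsT -sum_nat_const; apply: leq_sum => c _.
by rewrite setU0.
Qed.

Lemma grown0 l u : grown l 0 [set u].
Proof.
have /card_gt0P[h _] := H0.
split; rewrite ?cards1 //; first by apply/set0Pn; exists u; rewrite inE.
by move=> M /(hom_recolor (fun=> h)); rewrite !expn0 !muln1.
Qed.

Lemma hom_grown l t S M : grown l t S ->
    (forall f : G -> H, #|extensions S f| <= M) ->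
  hom G H <= #|H| * D ^ (#|S| - 1) * M.
Proof.
case=> _ _ leS bound /bound /leq_trans; apply.
rewrite leq_mul2r leq_mul2l; apply/orP; right; apply/orP; right.
have -> : #|S| - 1 = 2 * t + (#|S| - (1 + 2 * t)) by lia.
rewrite expnD leq_mul2r; apply/orP; right.
by rewrite expnM; case: t {bound leS} => // t; rewrite leq_exp2r ?leq_pred.
Qed.

Variable l : nat.
Hypothesis rare : forall k, l <= k ->
  forall i j : H, #|H| * D ^ 2 * walks k i j < s H * D ^ k.
(* G has at least s(H) D^(n-2) colorings; the factor D^2 avoids a subtraction. *)
Hypothesis big_hom : s H * D ^ #|G| <= D ^ 2 * hom G H.

(** An ear with k > l edges alone would make the colorings too few: around it, a
    tree count gives |H| D^(n-k) colorings, and the ear allows fewer than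
    s(H) D^(k-2) / |H| for each of them. *)
Lemma long_ear_short t S x p y : grown l t S -> long_ear S x p y -> size p < l.
Proof.
move=> grS ear; rewrite ltnNge; apply/negP => lp.
have cS := ear_set_card ear; have [[xS yS] xy up outS p2] := ear.
have [q qE] : {q : H * H | \max_(q : H * H) walks (size p).+1 q.1 q.2 =
    walks (size p).+1 q.1 q.2}.
  by apply: eq_bigmax; rewrite card_prod muln_gt0 H0.
set W := walks _ _ _ in qE.
have bound (f : G -> H) : #|extensions S f| <= W * D ^ #|~: (S :|: [set z in p])|.
  apply: leq_trans (extensions_ear f xS yS xy up outS _) _.
    move=> f'; apply: extensions_connected conG _ => //.
    by apply/set0Pn; exists x; rewrite inE xS.
  rewrite leq_mul2r -qE; apply/orP; right.
  exact: (leq_bigmax (f x, f y)).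
have := hom_grown grS bound; have := rare (leqW lp) q.1 q.2; rewrite -/W.
have S1 : 0 < #|S| by apply/card_gt0P; exists x.
have nE : #|G| = (#|S| - 1) + (size p).+1 + #|~: (S :|: [set z in p])|.
  by have := cardsC (S :|: [set z in p]); rewrite cS; lia.
move: big_hom; rewrite nE !expnD; set A := D ^ (#|S| - 1); set B := D ^ _.+1.
set C := D ^ _; have : 0 < A * C by rewrite muln_gt0 !expn_gt0 D0.
move: (hom G H) (s H) => h sH AC; nia.
Qed.

Lemma grown_step t S x p y : grown l t S -> long_ear S x p y ->
  grown l t.+1 (S :|: [set z in p]).
Proof.
move=> grS ear; have lp := long_ear_short grS ear.
have cS := ear_set_card ear; have [_ _ _ _ p2] := ear.
case: grS => S0 leS geS bound; split; rewrite ?cS; try lia.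
  by apply: contraNneq S0 => /eqP; rewrite setU_eq0 => /andP[].
move=> M leM.
apply: leq_trans (bound _ (fun f => extensions_long_ear f ear leM)) _.
have -> : #|S| + size p - (1 + 2 * t.+1) = #|S| - (1 + 2 * t) + (size p - 2) by lia.
rewrite expnD [_ ^ t.+1]expnS.
move: ((D ^ 2).-1 ^ t) (D ^ 2).-1 (D ^ (_ - 2)) => a R b.
by apply: eq_leq; nia.
Qed.

Lemma grown_bounded L S :
  #|H| * D * (D ^ 2).-1 ^ L < (D ^ 2) ^ L -> grown l L S -> False.
Proof.
move=> decay [S0 _ geS bound].
have := bound _ (fun f : G -> H => extensions_connected f conG S0).
have : s H > 0 by apply: s_gt0.
have nE : #|G| = 2 * L + (#|S| - (1 + 2 * L) + #|~: S|).+1.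
  by have := cardsC S; lia.
move: big_hom decay; rewrite nE expnD expnM (expnS D (_ + _)) expnD.
have : 0 < D ^ (#|S| - (1 + 2 * L)) * D ^ #|~: S| by rewrite muln_gt0 !expn_gt0 D0.
move: (D ^ (#|S| - _)) (D ^ #|~: S|) ((D ^ 2).-1 ^ L) ((D ^ 2) ^ L) => a b R Q.
move: (hom G H) (s H) (#|H|) => h sH cH ab0 big decay s0 le.
have k0 : 0 < D * (a * b) by rewrite muln_gt0 D0.
have := leq_trans big (leq_mul (leqnn (D ^ 2)) le).
have -> : D ^ 2 * (cH * (R * a) * b) = cH * D * R * (D * (a * b)).
  by rewrite -mulnn; nia.
by rewrite mulnA leq_mul2r eqn0Ngt k0 leqNgt (leq_trans decay) // leq_pmull.
Qed.

(** Adding long ears must stop, before L of them, at a set of at most 1 + L l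
    vertices; each outer vertex then has two neighbors in this set, and the
    pigeonhole principle applies. *)
Lemma popular_pair m L : two_connected G ->
    #|H| * D * (D ^ 2).-1 ^ L < (D ^ 2) ^ L ->
    (1 + L * l) + (1 + L * l) ^ 2 * m < #|G| ->
  exists a b : G, a != b /\ m <= #|N a :&: N b|.
Proof.
move=> tcG decay big.
suff: [exists a : G, exists b : G, (a != b) && (m <= #|N a :&: N b|)].
  by case/existsP=> a /existsP[b /andP[]]; exists a, b.
apply: contraT; rewrite negb_exists => /forallP none.
have few (a b : G) : a != b -> #|N a :&: N b| <= m.
  have := none a; rewrite negb_exists => /forallP/(_ b).
  by rewrite negb_and -ltnNge => /orP[/negPf->//|/ltnW].
suff nogrown q : forall t S, t + q = L -> ~ grown l t S.
  have /card_gt0P[u _] : 0 < #|G| by lia.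
  by case: (nogrown L 0 [set u] _ (grown0 l u)).
elim: q => [|q IH] t S tq grS.
  by rewrite addn0 in tq; subst t; apply: grown_bounded decay grS.
have noear x p z : ~ long_ear S x p z.
  by move=> ear; apply: (IH t.+1 _ _ (grown_step grS ear)); lia.
have [S0 leS geS _] := grS.
have sum_ge : #|~: S| <= \sum_(w in ~: S) \sum_(q in setX S S | q.1 != q.2)
    (w \in N q.1 :&: N q.2).
  rewrite -sum1_card; apply: leq_sum => w; rewrite inE => wS.
  have [x [y [xS yS xy wx wy]]] := two_nbrs_inside tcG S0 noear wS.
  by rewrite (bigD1 (x, y)) /= !inE ?xS ?yS ?xy // ![adj _ w]adj_sym wx wy.
have sum_le : #|~: S| <= #|S| ^ 2 * m.
  apply: leq_trans sum_ge _; rewrite exchange_big -mulnn -cardsX -sum_nat_const /=.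
  rewrite big_mkcondr; apply: leq_sum => -[a b] _ /=; case: ifP => // ab.
  apply: leq_trans (few a b ab); rewrite -sum1_card big_mkcond [leqRHS]big_mkcond.
  by apply: leq_sum => w _; case: (w \in _ :&: _); case: ifP.
have L1 : #|S| <= 1 + L * l.
  by apply: leq_trans leS _; rewrite leq_add2l leq_mul2r -tq leq_addr orbT.
have := leq_mul (leq_mul L1 L1) (leqnn m); rewrite !mulnn.
by have := cardsC S; lia.
Qed.

End Graph.

(** The colorings of G are split by the colors of a and b: there are s(H) pairs
    of twins and at most |H|^2 other pairs. *)
Lemma hom_split (G : sgraph) (a b : G) Y Z : a != b ->
    (forall f : G -> H, #|N (f a) :&: N (f b)| = D ->
       #|extensions [set a; b] f| <= Y) ->
    (forall f : G -> H, #|N (f a) :&: N (f b)| < D ->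
       #|extensions [set a; b] f| <= Z) ->
  hom G H <= s H * Y + #|H| ^ 2 * Z.
Proof.
move=> ab leY leZ; have /card_gt0P[h _] := H0.
rewrite -(extensions_set0 (fun _ : G => h)).
apply: leq_trans (extensions_step (w := b) (C := setT) _) _ => [g _|].
  by rewrite inE.
pose F c d := recolor (recolor (fun _ : G => h) b d) a c.
apply: leq_trans (_ : _ <= \sum_d \sum_c #|extensions [set a; b] (F c d)|) _.
  rewrite big_mkcond; apply: leq_sum => d _; rewrite inE setU0.
  apply: leq_trans (extensions_step (w := a) (C := setT) _) _ => [g _|].
    by rewrite inE.
  by apply: eq_leq; apply: eq_bigl => c; rewrite inE.
rewrite exchange_big pair_big /=.
apply: leq_trans (_ : _ <= \sum_(p : H * H)
    ((#|N p.1 :&: N p.2| == D) * Y + Z)) _.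
  apply: leq_sum => -[c d] _ /=.
  have [Fa Fb] : F c d a = c /\ F c d b = d.
    by rewrite /F /recolor !eqxx eq_sym (negPf ab).
  case: eqP => [e|/eqP ne].
    by rewrite mul1n (leq_trans (leY _ _)) ?leq_addr // Fa Fb.
  by rewrite leZ // Fa Fb ltn_neqAle ne codeg_max.
rewrite big_split /= -big_distrl sum_nat_const card_prod mulnn leq_add2r.
rewrite leq_mul2r /s -sum1_card big_mkcond [leqRHS]big_mkcond; apply/orP; right.
by apply: leq_sum => p _; rewrite inE -/D; case: eqP.
Qed.

Definition contains_K2 (G : sgraph) (a b : G) :=
  a != b /\ forall w, w \notin [set a; b] -> adj a w /\ adj b w.

(** A long ear from {a, b} would leave at most s(H) (D^2 - 1) D^(n-4) colorings
    with twins on a and b.  Those without are fewer than D^(n-4), because each of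
    the m common neighbors has at most D - 1 colors.  The total would stay
    below s(H) D^(n-2). *)
Lemma contains_K2_of_big_hom (G : sgraph) (a b : G) m : two_connected G ->
    s H * D ^ #|G| <= D ^ 2 * hom G H ->
    #|H| ^ 2 * D ^ 2 * D.-1 ^ m < D ^ m ->
    a != b -> m = #|N a :&: N b| ->
  contains_K2 a b.
Proof.
move=> tcG big few ab mE; have [_ conG _] := tcG.
set S := [set a; b]; have cS : #|S| = 2 by rewrite cards2 ab.
have S0 : S != set0 by rewrite -card_gt0 cS.
have [aS bS] : a \in S /\ b \in S by rewrite !inE !eqxx orbT.
suff noear x p z : ~ long_ear S x p z.
  split=> // w wS; have [x [y [xS yS xy wx wy]]] := two_nbrs_inside tcG S0 noear wS.
  rewrite ![adj _ w]adj_sym; move: xS yS xy wx wy; rewrite !inE.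
  by move=> /orP[]/eqP-> /orP[]/eqP->; rewrite ?eqxx.
move=> ear; have cE := ear_set_card ear.
have [[xS _] _ _ _ p2] := ear.
have Eset0 : S :|: [set u in p] != set0.
  by apply/set0Pn; exists x; rewrite inE xS.
have leC : 2 + size p + #|~: (S :|: [set u in p])| = #|G|.
  by have := cardsC (S :|: [set u in p]); rewrite cE cS.
pose W := N a :&: N b.
have WS : [disjoint W & S].
  rewrite disjoint_sym disjoints_subset; apply/subsetP => u.
  by rewrite !inE => /orP[]/eqP->; rewrite ?adj_irr ?andbF.
have WG : 2 + m + #|~: (S :|: [set u in enum W])| = #|G|.
  have := cardsC (S :|: [set u in enum W]); rewrite set_enum cardsU.
  have -> : S :&: W = set0 by apply/eqP; rewrite setI_eq0 disjoint_sym.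
  by rewrite cards0 cS -mE subn0.
have twins (f : G -> H) : #|extensions S f| <= D ^ (size p - 2) * (D ^ 2).-1 *
    D ^ #|~: (S :|: [set u in p])|.
  by apply: extensions_long_ear ear _ => f'; apply: extensions_connected.
have nontwins (f : G -> H) : #|N (f a) :&: N (f b)| < D ->
    #|extensions S f| <= D.-1 ^ m * D ^ #|~: (S :|: [set u in enum W])|.
  move=> lt; apply: leq_trans (extensions_common (p := enum W) f aS bS _ _ _) _.
  - move=> u; rewrite mem_enum => uW; split; last 2 first.
    + by move: uW; rewrite !inE => /andP[].
    + by move: uW; rewrite !inE => /andP[].
    by apply/negP => uS; move/pred0P/(_ u): WS; rewrite /= uW uS.
  - exact: enum_uniq.
  - move=> f'; apply: extensions_connected conG _.
    by apply/set0Pn; exists a; rewrite inE aS.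
  rewrite -cardE -/W -mE leq_mul2r; apply/orP; right.
  case: m {few mE WG} => // m; rewrite leq_exp2r // -ltnS prednK //.
have := hom_split ab (fun f _ => twins f) nontwins.
set c1 := #|~: (_ :|: [set u in p])|; set c2 := #|~: (_ :|: [set u in enum W])|.
pose e := size p - 2 + c1.
have nE : #|G| = 4 + e by rewrite /e /c1; lia.
have rare : #|H| ^ 2 * (D.-1 ^ m * D ^ c2) < D ^ e.
  have D20 : 0 < D ^ 2 by rewrite expn_gt0 D0.
  rewrite -(ltn_pmul2l D20) -expnD.
  have -> : 2 + e = m + c2 by rewrite /c2; lia.
  by rewrite expnD 2!mulnA [D ^ 2 * _]mulnC ltn_mul2r expn_gt0 D0 few.
have DE : D ^ (size p - 2) * (D ^ 2).-1 * D ^ c1 = (D ^ 2).-1 * D ^ e.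
  by rewrite /e expnD mulnAC mulnC.
rewrite DE => le; have sH := s_gt0 H0.
have {}le : hom G H < s H * (D ^ 2 * D ^ e).
  apply: leq_ltn_trans le _; rewrite -[D ^ 2 in ltnRHS]prednK ?expn_gt0 ?D0 //.
  rewrite mulSn mulnDr [ltnRHS]addnC ltn_add2l (leq_trans rare) //.
  by rewrite leq_pmull.
move: big; rewrite nE leqNgt => /negP; apply.
have -> : D ^ (4 + e) = D ^ 2 * (D ^ 2 * D ^ e) by rewrite -!expnD.
by rewrite mulnCA ltn_mul2l expn_gt0 D0.
Qed.

End Growth.

(** * Colorings of K_{2,n} *)

Lemma hom_K2_ge (H : graph) n : s H * maxdeg H ^ n <= hom (Kab 2 n) H.
Proof.
pose cn (p : H * H) := enum (N p.1 :&: N p.2).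
pose phi (q : (H * H) * {ffun 'I_n -> 'I_(maxdeg H)}) : {ffun Kab 2 n -> H} :=
  [ffun x => match x with
             | inl i => if i == ord0 then q.1.1 else q.1.2
             | inr i => nth q.1.1 (cn q.1) (q.2 i)
             end].
pose A := setX [set p : H * H | #|N p.1 :&: N p.2| == maxdeg H]
               [set: {ffun 'I_n -> 'I_(maxdeg H)}].
have szA q i : q \in A -> q.2 i < size (cn q.1).
  by rewrite !inE andbT /cn -cardE => /eqP->.
have -> : s H * maxdeg H ^ n = #|phi @: A|.
  rewrite card_in_imset ?cardsX ?cardsT ?card_ffun ?card_ord // => q q' qA q'A e.
  have e1 x : phi q x = phi q' x by rewrite e.
  have q1 : q.1 = q'.1.
    have := e1 (inl ord0); have := e1 (inl ord_max); rewrite !ffunE /=.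
    by case: (q.1) (q'.1) => ? ? [? ?] /= -> ->.
  suff q2 : q.2 = q'.2 by case: q q' q1 q2 {qA q'A e e1} => ? ? [? ?] /= -> ->.
  apply/ffunP => i; apply/val_inj => /=; have := e1 (inr i); rewrite !ffunE -q1.
  move=> /eqP; rewrite nth_uniq ?enum_uniq ?szA //; first by move/eqP.
  by rewrite q1 szA.
apply/subset_leq_card/subsetP => _ /imsetP[q qA ->]; rewrite inE.
have com i : (adj q.1.1 (phi q (inr i)) * adj q.1.2 (phi q (inr i)))%type.
  rewrite ffunE; have := mem_nth q.1.1 (szA q i qA).
  by rewrite mem_enum !inE => /andP[].
apply/coloringP => -[i|i] [j|j] //= _.
  by rewrite [phi q (inl i)]ffunE; case: ifP => _; rewrite com.
by rewrite [phi q (inl j)]ffunE adj_sym; case: ifP => _; rewrite com.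
Qed.

Section SpanningSubgraph.

Variables (G K : sgraph) (H : graph) (h : K -> G).
Hypotheses (bijh : bijective h) (homh : forall x y : K, adj x y -> adj (h x) (h y)).

Let pull (g : {ffun G -> H}) : {ffun K -> H} := [ffun x => g (h x)].

Lemma pull_inj : injective pull.
Proof.
case: bijh => k hk kh g g' e; apply/ffunP => x.
by have /ffunP/(_ (k x)) := e; rewrite !ffunE kh.
Qed.

Lemma pull_colorings :
  pull @: [set g | is_coloring g] \subset [set f | is_coloring f].
Proof.
apply/subsetP => _ /imsetP[g /[!inE] /coloringP gP ->]; apply/coloringP => x y xy.
by rewrite !ffunE gP ?homh.
Qed.

Lemma hom_spanning : hom G H <= hom K H.
Proof.
by rewrite /hom -(card_imset _ pull_inj) subset_leq_card ?pull_colorings.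
Qed.

(** G has the edges of K and possibly more, so its colorings are among those of K;
    when the numbers agree no coloring of K may violate an edge of G. *)
Lemma coloring_of_hom_eq (f : K -> H) : hom G H = hom K H ->
    (forall x y : K, adj x y -> adj (f x) (f y)) ->
  forall x y : K, adj (h x) (h y) -> adj (f x) (f y).
Proof.
move=> e fP x y hxy.
have eqS : pull @: [set g | is_coloring g] = [set f | is_coloring f].
  apply/eqP; rewrite eqEcard pull_colorings (card_imset _ pull_inj).
  by rewrite andTb -[leqLHS]/(hom K H) -[leqRHS]/(hom G H) e.
have : finfun f \in pull @: [set g | is_coloring g].
  by rewrite eqS inE; apply/coloringP => u v uv; rewrite !ffunE fP.
case/imsetP=> g /[!inE] /coloringP gP /ffunP fE.
by have := fE x; have := fE y; rewrite !ffunE => -> ->; apply: gP.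
Qed.

End SpanningSubgraph.

Lemma isomorphic_sym (G K : graph) : isomorphic G K -> isomorphic K G.
Proof.
move=> [h [k hk kh] hadj]; exists k; first by exists h.
by move=> x y; rewrite -hadj !kh.
Qed.

Lemma hom_isomorphic (G K : sgraph) (H : graph) :
  isomorphic G K -> hom G H = hom K H.
Proof.
have le (G1 G2 : sgraph) : isomorphic G1 G2 -> hom G2 H <= hom G1 H.
  by move=> [h bijh hadj]; apply: (hom_spanning H bijh) => x y; rewrite hadj.
by move=> iso; apply/eqP; rewrite eqn_leq !le //; apply: isomorphic_sym.
Qed.

Lemma K2_spanning (G : sgraph) (a b : G) : contains_K2 a b ->
  exists2 h : Kab 2 (#|G| - 2) -> G, bijective h &
    forall x y, adj x y -> adj (h x) (h y).
Proof.
move=> [ab con].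
have e : #|G| - 2 = #|~: [set a; b]|.
  by rewrite -(cardsC [set a; b]) cards2 ab addKn.
pose h (x : Kab 2 (#|G| - 2)) : G := match x with
  | inl i => if i == ord0 then a else b
  | inr i => enum_val (cast_ord e i) end.
have out i : h (inr i) \notin [set a; b].
  by have := enum_valP (cast_ord e i); rewrite inE.
have ins i : h (inl i) \in [set a; b].
  by rewrite /h; case: ifP; rewrite !inE eqxx ?orbT.
exists h.
  apply: inj_card_bij; last first.
    rewrite card_sum !card_ord.
    suff : #|[set a; b]| <= #|G| by rewrite cards2 ab; lia.
    exact: max_card.
  move=> [i|i] [j|j] hE.
  - congr inl; apply/val_inj; move: hE; rewrite /h.
    case: i => [[|[|//]] ?]; case: j => [[|[|//]] ?] //= hE.
      by rewrite hE eqxx in ab.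
    by rewrite hE eqxx in ab.
  - by have := ins i; rewrite hE (negPf (out j)).
  - by have := ins j; rewrite -hE (negPf (out i)).
  - by move: hE => /enum_val_inj/cast_ord_inj->.
have adjE i j : adj (h (inl i)) (h (inr j)).
  by have [aj bj] := con _ (out j); rewrite {1}/h; case: ifP.
by move=> [i|i] [j|j] // _; rewrite 1?adj_sym adjE.
Qed.

(** Such an edge joins two vertices x and y on the same side of K_{2,n}.  Color x by
    i, the rest of this side by j and the other side by c: this is a coloring of
    K_{2,n}, which respects the extra edge only if i and j are adjacent. *)
Lemma transitive_of_extra_edge (G : sgraph) (H : graph) n (h : Kab 2 n -> G) x y :
    bijective h -> (forall x y, adj x y -> adj (h x) (h y)) ->
    hom G H = hom (Kab 2 n) H -> adj (h x) (h y) -> ~~ adj x y ->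
  forall i j c : H, adj c i -> adj c j -> adj i j.
Proof.
move=> bijh homh e hxy nxy i j c ci cj.
pose f z := if z == x then i else if is_inl z == is_inl x then j else c.
have yx : y != x by apply: contraTneq hxy => ->; rewrite adj_irr.
have sxy : is_inl y == is_inl x by move: nxy; rewrite /= /Kab_adj negbK eq_sym.
have <- : f x = i by rewrite /f eqxx.
have <- : f y = j by rewrite /f (negPf yx) sxy.
apply: (coloring_of_hom_eq bijh homh e) hxy => u v; rewrite /= /Kab_adj.
have side w : if is_inl w == is_inl x then is_true (adj c (f w)) else f w = c.
  rewrite /f; case: (w =P x) => [->|_]; first by rewrite eqxx.
  by case: (is_inl w == is_inl x).
move: (side u) (side v).
by case: (is_inl u) (is_inl v) (is_inl x) => [] [] [] //=;
   (move=> cu -> || move=> -> cv); rewrite // adj_sym.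
Qed.

(** * The extremal theorem *)

Lemma K2_extremal (H : graph) : connected H -> 0 < maxdeg H ->
    (forall i j : H, walks 3 i j < maxdeg H ^ 2) ->
    (exists l, forall k, l <= k -> forall i j : H,
       #|H| * maxdeg H ^ 2 * walks k i j < s H * maxdeg H ^ k) ->
  exists c : nat, forall (n : nat) (G : sgraph),
    c <= n -> #|G| = n -> two_connected G ->
    hom G H <= hom (Kab 2 (n - 2)) H /\
    (hom G H = hom (Kab 2 (n - 2)) H <-> isomorphic G (Kab 2 (n - 2))).
Proof.
move=> conH D0 walks3_lt [l rare]; have H0 := conH.1.
have D20 : 0 < maxdeg H ^ 2 by rewrite expn_gt0 D0.
have [m few] := eventually_geometric (#|H| ^ 2 * maxdeg H ^ 2) D0.
have [L /(_ L (leqnn L)) decay] := eventually_geometric (#|H| * maxdeg H) D20.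
exists ((1 + L * l) + (1 + L * l) ^ 2 * m).+1 => n G ltn nE tcG; subst n.
have [G2 conG _] := tcG; have K2_ge := hom_K2_ge H (#|G| - 2).
have [big|small] :=
  leqP (s H * maxdeg H ^ #|G|) (maxdeg H ^ 2 * hom G H); last first.
  have lt : hom G H < hom (Kab 2 (#|G| - 2)) H.
    apply: leq_trans K2_ge; rewrite -(ltn_pmul2l D20) mulnCA -expnD subnKC //.
    exact: ltnW.
  split; first exact: ltnW.
  split=> [e|/hom_isomorphic e]; first by rewrite e ltnn in lt.
  by rewrite (e H) ltnn in lt.
have [a [b [ab leW]]] := popular_pair H0 D0 walks3_lt conG rare big tcG decay ltn.
have conK : contains_K2 a b.
  by apply: contains_K2_of_big_hom (few _ leW) ab erefl.
have [h bijh homh] := K2_spanning conK.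
split; first exact: hom_spanning bijh homh.
split=> [e|]; last exact: hom_isomorphic.
apply: isomorphic_sym; exists h => // x y; apply/idP/idP; last exact: homh.
move=> hxy; apply: contraT => nxy.
have [v] := walks3_of_transitive D0 (transitive_of_extra_edge bijh homh e hxy nxy).
by rewrite leqNgt walks3_lt.
Qed.

Theorem theorem1p4 :
  (forall H : graph,
     connected H ->
     ~ (exists d : nat, regular H d) ->
     exists c : nat, forall (n : nat) (G : sgraph),
       c <= n -> #|G| = n -> two_connected G ->
       hom G H <= hom (Kab 2 (n - 2)) H /\
       (hom G H = hom (Kab 2 (n - 2)) H <-> isomorphic G (Kab 2 (n - 2))))
  /\
  (forall H : graph,
     connected H ->
     0 < maxdeg H ->
     regular H (maxdeg H) ->
     (if loopless H && bipartite H then 2 * maxdeg H ^ 2 + 1 <= s H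
      else maxdeg H ^ 2 + 1 <= s H) ->
     exists c : nat, forall (n : nat) (G : sgraph),
       c <= n -> #|G| = n -> two_connected G ->
       hom G H <= hom (Kab 2 (n - 2)) H /\
       (hom G H = hom (Kab 2 (n - 2)) H <-> isomorphic G (Kab 2 (n - 2)))).
Proof.
split=> H conH.
  move=> nreg; have nregD : ~ regular H (maxdeg H).
    by move=> reg; apply: nreg; exists (maxdeg H).
  have D0 : 0 < maxdeg H.
    rewrite lt0n; apply/eqP => D0; apply: nregD => v.
    by apply/eqP; rewrite eqn_leq deg_max D0.
  apply: K2_extremal => //.
    move=> i j; rewrite ltnNge; apply/negP => le3.
    exact: nregD (regular_of_walks3 conH D0 le3).
  have [l rare] := walks_rare_nonregular (#|H| * maxdeg H ^ 2) conH nregD.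
  exists l => k lk i j; apply: leq_trans (rare k lk i j) _.
  by rewrite leq_pmull // s_gt0 // conH.1.
move=> D0 reg twins; apply: K2_extremal => //.
  move=> i j; rewrite ltnNge; apply/negP => /(few_twins_of_walks3 conH D0).
  by case: ifP twins => _; rewrite addn1 => /leq_trans lt /lt; rewrite ltnn.
pose kappa := if bipartite H then 2 else 1.
apply: (walks_equidistribute (kappa := kappa) conH reg D0).
- by rewrite /kappa; case: ifP.
- move=> j; have [->|[bip le]] := card_even_class conH reg D0 j.
    by rewrite cardsT leq_pmull // /kappa; case: ifP.
  by rewrite /kappa bip.
have bl : bipartite H -> loopless H.
  move=> /existsP[A /forallP AP]; apply/forallP => x; apply/negP => xx.
  by have /forallP/(_ x) := AP x; rewrite xx eqxx.
move: twins bl; rewrite /kappa.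
case: (bipartite H) => [/[swap] -> //|]; rewrite /= ?andbF addn1 ?mul1n //.
Qed.
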